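(* Let $p\geq 3$ be a prime and let $$\phi_p(x)=(x-p)^2+2p-p^2\in\mathbb{Q}[x].$$ Then $G_{\mathbb{Q}}(\phi_p)\cong [C_2]^\infty$ in any of the following cases: (1) $p\equiv 2 \pmod 3$; (2) $p\equiv 3\pmod 4$; (3) $p\equiv 2\pmod 5$; (4) $p\equiv 3,6\pmod 7$; (5) $p\equiv 2,3,5,7,10\pmod{11}$; (6) $p\equiv 2,3,7,9,11\pmod{13}$. Moreover, $G_{\mathbb{Q}}(\phi_p)\cong [C_2]^\infty$ for all primes $3\le p<5000$.
   Context: For a number field $K$ and a polynomial $\varphi(x)\in K[x]$, let $\varphi^n$ denote the $n$th iterate (under composition) of $\varphi$, let $K_n(\varphi)$ be the splitting field of $\varphi^n$ over $K$ (inside a fixed algebraic closure), and let $G_{K,n}(\varphi)=\mathrm{Gal}(K_n(\varphi)/K)$. Set $G_K(\varphi)=\varprojlim_n G_{K,n}(\varphi)$, the inverse limit with respect to the natural restriction surjections $G_{K,n}(\varphi)\to G_{K,n-1}(\varphi)$. $C_2$ is the cyclic permutation group of order $2$ on two letters; $[C_2]^n$ denotes its $n$-fold iterated wreath product (equivalently, the automorphism group of the complete rooted binary tree of height $n$), and $[C_2]^\infty=\varprojlim_n [C_2]^n$ is the infinite iterated wreath product (the automorphism group of the infinite complete rooted binary tree). *)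

(* Defs.v *)
From HB Require Import structures.
From mathcomp Require Import all_boot all_order all_fingroup all_algebra all_field.
From mathcomp Require Import all_classical topology.

Set Implicit Arguments.
Unset Strict Implicit.
Unset Printing Implicit Defensive.

Import GRing.Theory Num.Theory.

Local Open Scope ring_scope.

Section InverseLimit.

Variables (G : nat -> groupType).
Variable r : forall n, {multiplicative G n.+1 -> G n}.

(* The topology of invlim r is the one induced by the product of the discrete *)
(* topologies on the G n.                                                     *)
Definition compatible_families :
    set (prod_topology (fun n => discrete_topology (G n))) :=
  [set x | forall n, r n (x n.+1) = x n]%classic.

Definition invlim : Type := set_type compatible_families.

HB.instance Definition _ := Topological.copy invlim (set_type compatible_families).

Local Notation family := (forall n, G n).

Definition invlim_proj (x : invlim) : family := sval x.

Lemma invlimP (x : invlim) n : r n (invlim_proj x n.+1) = invlim_proj x n.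
Proof. by case: x => x xP; exact: (set_mem xP). Qed.

Definition to_invlim (x : family) (xP : forall n, r n (x n.+1) = x n) : invlim :=
  exist _ x (mem_set (xP : compatible_families x)).

Lemma invlim_ext (x y : invlim) :
  (forall n, invlim_proj x n = invlim_proj y n) -> x = y.
Proof.
move=> xy; apply: val_inj => /=.
exact: (@functional_extensionality_dep _ _ (sval x) (sval y)).
Qed.

Fact gmulf1_r n : r n 1%g = 1%g.
Proof.
by apply: (@mulgI _ (r n 1%g)); rewrite -gmulfM !mulg1.
Qed.

Fact invlim_oneP n : r n ((fun m => 1%g : G m) n.+1) = (1%g : G n).
Proof. exact: gmulf1_r. Qed.

Fact invlim_mulP (x y : invlim) n :
  r n (invlim_proj x n.+1 * invlim_proj y n.+1)%g =
  (invlim_proj x n * invlim_proj y n)%g.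
Proof. by rewrite gmulfM !invlimP. Qed.

Fact invlim_invP (x : invlim) n :
  r n (invlim_proj x n.+1)^-1%g = (invlim_proj x n)^-1%g.
Proof.
apply: (@mulgI _ (invlim_proj x n)).
by rewrite -{1}invlimP -gmulfM !mulgV gmulf1_r.
Qed.

Definition invlim_one := @to_invlim (fun n => 1%g) invlim_oneP.
Definition invlim_mul x y :=
  @to_invlim (fun n => invlim_proj x n * invlim_proj y n)%g (invlim_mulP x y).
Definition invlim_inv x :=
  @to_invlim (fun n => (invlim_proj x n)^-1)%g (invlim_invP x).

Fact invlim_mulA : associative invlim_mul.
Proof. by move=> x y z; apply: invlim_ext => n /=; rewrite mulgA. Qed.
Fact invlim_mul1g : left_id invlim_one invlim_mul.
Proof. by move=> x; apply: invlim_ext => n /=; rewrite mul1g. Qed.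
Fact invlim_mulg1 : right_id invlim_one invlim_mul.
Proof. by move=> x; apply: invlim_ext => n /=; rewrite mulg1. Qed.
Fact invlim_mulVg : left_inverse invlim_one invlim_inv invlim_mul.
Proof. by move=> x; apply: invlim_ext => n /=; rewrite mulVg. Qed.
Fact invlim_mulgV : right_inverse invlim_one invlim_inv invlim_mul.
Proof. by move=> x; apply: invlim_ext => n /=; rewrite mulgV. Qed.

HB.instance Definition _ := isGroup.Build invlim
  invlim_mulA invlim_mul1g invlim_mulg1 invlim_mulVg invlim_mulgV.

End InverseLimit.

(* Isomorphism of topological groups, as usual for profinite groups.          *)
Definition invlim_isog (G H : nat -> groupType)
    (r : forall n, {multiplicative G n.+1 -> G n})
    (s : forall n, {multiplicative H n.+1 -> H n}) : Prop :=
  exists (f : {multiplicative invlim r -> invlim s}) (g : invlim s -> invlim r),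
    [/\ cancel f g, cancel g f, continuous f & continuous g].

Local Notation pQtoC := (map_poly (@ratr algC)).

(* The zero polynomial is given no roots, so that its splitting field is rat. *)
Definition rootsC (P : {poly rat}) : seq algC :=
  if P == 0 then [::] else sval (closed_field_poly_normal (pQtoC P)).

Lemma rootsCP (P : {poly rat}) :
  P != 0 -> pQtoC P = lead_coef (pQtoC P) *: \prod_(z <- rootsC P) ('X - z%:P).
Proof.
by rewrite /rootsC => /negPf->; case: closed_field_poly_normal.
Qed.

Lemma mem_rootsC (P : {poly rat}) z :
  (z \in rootsC P) = (P != 0) && root (pQtoC P) z.
Proof.
have [-> | P0] /= := eqVneq P 0; first by rewrite /rootsC eqxx.
rewrite rootsCP // rootZ ?root_prod_XsubC //.
by rewrite lead_coef_eq0 map_poly_eq0.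
Qed.

Lemma splitting_num_field_exists (P : {poly rat}) :
  {L : splittingFieldType rat & {iota : {rmorphism L -> algC} |
    exists2 s : seq L, map iota s = rootsC P & <<1 & s>>%VS = {:L}%VS}}.
Proof.
have [L [iota [s iota_s genL]]] := num_field_exists (rootsC P).
have splitL : SplittingField.axiom L.
  exists (\prod_(z <- s) ('X - z%:P)); last by exists s; rewrite ?eqpxx.
  have [P0 | P0] := eqVneq P 0.
    have ->: s = [::] by move: iota_s; rewrite P0 /rootsC eqxx; case: (s).
    by rewrite big_nil rpred1.
  have lP0: lead_coef P != 0 by rewrite lead_coef_eq0.
  have ->: \prod_(z <- s) ('X - z%:P) = map_poly (in_alg L) ((lead_coef P)^-1 *: P).
    apply: (map_poly_inj iota); rewrite -map_poly_comp rmorph_prod /=.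
    transitivity (\prod_(z <- rootsC P) ('X - z%:P)).
      by rewrite -iota_s big_map; apply: eq_bigr => z _; rewrite map_polyXsubC.
    have -> : map_poly (iota \o in_alg L) ((lead_coef P)^-1 *: P) =
              pQtoC ((lead_coef P)^-1 *: P).
      by apply: eq_map_poly => a /=; rewrite alg_num_field fmorph_rat.
    rewrite map_polyZ /= [X in _ *: X]rootsCP // scalerA lead_coef_map.
    by rewrite -rmorphM /= mulVf // rmorph1 scale1r.
  by apply/polyOverP => i; rewrite coef_map /= rpredZ ?mem1v.
pose mL := FieldExt_isSplittingField.Build rat L splitL.
pose L' : splittingFieldType rat := HB.pack L mL.
by exists L', iota; exists s.
Qed.

Definition splitting_field (P : {poly rat}) : splittingFieldType rat :=
  tag (splitting_num_field_exists P).

Definition splitting_field_emb (P : {poly rat}) :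
    {rmorphism splitting_field P -> algC} :=
  sval (tagged (splitting_num_field_exists P)).

Lemma splitting_field_gen (P : {poly rat}) :
  exists2 s : seq (splitting_field P),
    map (splitting_field_emb P) s = rootsC P & <<1 & s>>%VS = fullv.
Proof. exact: svalP (tagged (splitting_num_field_exists P)). Qed.

Lemma restrict_gal (L1 L2 : splittingFieldType rat)
    (iota1 : {rmorphism L1 -> algC}) (iota2 : {rmorphism L2 -> algC}) :
    (forall a, exists b, iota2 b = iota1 a) ->
  forall tau : gal_of {:L2},
  {sigma : gal_of {:L1} |
     forall a b, iota1 a = iota2 b -> iota1 (sigma a) = iota2 (tau b)}.
Proof.
move=> sub12 tau.
have tau_ex a : exists c, forall b, iota1 a = iota2 b -> iota1 c = iota2 (tau b).
  have [b Db] := sub12 a.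
  suffices [c Dc]: exists c, iota1 c = iota2 (tau b).
    by exists c => b'; rewrite -Db => /fmorph_inj <-.
  have [rs /eqP Drs] := splitting_field_normal 1%AS a.
  have /polyOver1P[q Dq] := minPolyOver 1%AS a.
  have q_C (L : splittingFieldType rat) (iota : {rmorphism L -> algC}) :
      map_poly iota (map_poly (in_alg L) q) = pQtoC q.
    rewrite -map_poly_comp; apply: eq_map_poly => x /=.
    by rewrite alg_num_field fmorph_rat.
  have qb0: root (map_poly (in_alg L2) q) b.
    rewrite -(fmorph_root iota2) q_C -(q_C _ iota1) Db fmorph_root -Dq.
    exact: root_minPoly.
  have: root (pQtoC q) (iota2 (tau b)).
    rewrite -(q_C _ iota2) fmorph_root.
    have <-: map_poly tau (map_poly (in_alg L2) q) = map_poly (in_alg L2) q.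
      rewrite -map_poly_comp; apply: eq_map_poly => x /=.
      by rewrite linearZ /= rmorph1.
    by rewrite fmorph_root.
  rewrite -(q_C _ iota1) -Dq Drs rmorph_prod /=.
  have ->: \prod_(z <- rs) map_poly iota1 ('X - z%:P) =
           \prod_(z <- map iota1 rs) ('X - z%:P).
    by rewrite big_map; apply: eq_bigr => z _; rewrite map_polyXsubC.
  by rewrite root_prod_XsubC => /mapP[c _ Dc]; exists c.
pose nu a := sval (cid (tau_ex a)).
have nuP a b : iota1 a = iota2 b -> iota1 (nu a) = iota2 (tau b).
  by rewrite /nu; case: cid => c /= /[apply].
have nuB : zmod_morphism nu.
  move=> x y; have [[x' Dx] [y' Dy]] := (sub12 x, sub12 y).
  apply: (fmorph_inj iota1); rewrite (nuP _ (x' - y')) ?rmorphB ?Dx ?Dy //=.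
  by rewrite (nuP x x') ?(nuP y y').
have nuM : monoid_morphism nu.
  split=> [|x y]; apply: (fmorph_inj iota1).
    by rewrite (nuP _ 1) ?rmorph1.
  have [[x' Dx] [y' Dy]] := (sub12 x, sub12 y).
  rewrite (nuP _ (x' * y')) ?rmorphM ?Dx ?Dy //=.
  by rewrite (nuP x x') ?(nuP y y').
pose nu_add := GRing.isZmodMorphism.Build L1 L1 nu nuB.
pose nu_mul := GRing.isMonoidMorphism.Build L1 L1 nu nuM.
pose nuR : {rmorphism L1 -> L1} := HB.pack nu nu_add nu_mul.
pose nu_lin := GRing.isScalable.Build rat L1 L1 *:%R nu (fmorph_numZ nuR).
pose nuL : {lrmorphism L1 -> L1} := HB.pack nu nu_add nu_mul nu_lin.
exists (gal {:L1} (linfun_ahom nuL)) => a b /nuP <-.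
rewrite galK ?subvf ?memvf //=; congr (iota1 _).
exact: (lfunE nuL).
Qed.

Section Arboreal.

Variable phi : {poly rat}.

Definition iterp n : {poly rat} := iter n (fun q => phi \Po q) 'X.

Definition K_ n : splittingFieldType rat := splitting_field (iterp n).
Definition iota_ n : {rmorphism K_ n -> algC} := splitting_field_emb (iterp n).

Lemma iterpSr n : iterp n.+1 = iterp n \Po phi.
Proof.
elim: n => [|n IHn] /=; first by rewrite comp_polyX comp_polyXr.
by rewrite -comp_polyA -IHn.
Qed.

Lemma rootsC_iterp n z :
  z \in rootsC (iterp n) -> exists b, iota_ n.+1 b = z.
Proof.
rewrite mem_rootsC => /andP[n0 rz].
have [s Ds _] := splitting_field_gen (iterp n.+1).
have [szphi | szphi] := leqP (size phi) 1.
  case: n n0 rz {s Ds} => [|n] n0 rz.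
    exists 0; rewrite rmorph0.
    by move: rz; rewrite /iterp /= map_polyX rootX => /eqP.
  move: n0 rz; rewrite /iterp /= (size1_polyC szphi) comp_polyC polyC_eq0.
  by move=> c0; rewrite map_polyC /= rootC fmorph_eq0 (negPf c0).
have [w /eqP Dw]: exists w, root (pQtoC phi - z%:P) w.
  apply/closed_rootP; rewrite size_polyDl ?size_map_poly ?gtn_eqF //.
  by rewrite size_polyN (leq_ltn_trans (size_polyC_leq1 _)).
have{} Dw: (pQtoC phi).[w] = z.
  by apply/eqP; rewrite -subr_eq0; rewrite hornerD hornerN hornerC in Dw; apply/eqP.
have: w \in rootsC (iterp n.+1).
  rewrite mem_rootsC iterpSr map_comp_poly /root horner_comp Dw [_ == 0]rz andbT.
  by rewrite comp_poly_eq0.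
rewrite -Ds => /mapP[b _ Db].
exists (map_poly (in_alg (K_ n.+1)) phi).[b].
rewrite -horner_map /= -[iota_ _ b]Db -Dw -map_poly_comp; congr _.[w].
by apply: eq_map_poly => x /=; rewrite alg_num_field fmorph_rat.
Qed.

Lemma iota_sub n (a : K_ n) : exists b, iota_ n.+1 b = iota_ n a.
Proof.
have [s Ds genL] := splitting_field_gen (iterp n).
have: a \in <<1 & s>>%VS by rewrite genL memvf.
have: {in s, forall x, exists b, iota_ n.+1 b = iota_ n x}.
  by move=> x sx; apply: rootsC_iterp; rewrite -Ds; apply: map_f.
elim/last_ind: s {Ds genL} a => [|s x IHs] a sP.
  rewrite Fadjoin_nil => /vlineP[k ->]; exists k%:A.
  by rewrite !alg_num_field !fmorph_rat.
rewrite adjoin_rcons => /Fadjoin_polyP[q /polyOverP qs ->].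
have [y Dy]: exists b, iota_ n.+1 b = iota_ n x.
  by apply: sP; rewrite mem_rcons mem_head.
have{sP} IH c : c \in <<1 & s>>%VS -> exists b, iota_ n.+1 b = iota_ n c.
  by apply: IHs => u us; apply: sP; rewrite mem_rcons mem_behead.
have [f Df]: exists f : nat -> K_ n.+1, forall i, iota_ n.+1 (f i) = iota_ n q`_i.
  have/choice := fun i => IH _ (qs i).
  by case=> f fP; exists f.
exists (\sum_(i < size q) f i * y ^+ i); rewrite horner_coef !rmorph_sum.
by apply: eq_bigr => i _; rewrite !rmorphM !rmorphXn /= Df Dy.
Qed.

(* gal_of {:K_ n} consists of all the rat-linear field automorphisms of K_ n. *)
Definition gal_iter n : groupType := gal_of {:K_ n}.

Definition gal_restr n (tau : gal_iter n.+1) : gal_iter n :=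
  sval (restrict_gal (@iota_sub n) tau).

Lemma gal_restrP n (tau : gal_iter n.+1) a b :
  iota_ n a = iota_ n.+1 b -> iota_ n (gal_restr tau a) = iota_ n.+1 (tau b).
Proof. exact: svalP (restrict_gal (@iota_sub n) tau) a b. Qed.

Fact gal_restrM n : {morph @gal_restr n : s t / (s * t)%g}.
Proof.
move=> s t; apply/eqP/gal_eqP => a _; apply: (fmorph_inj (iota_ n)).
have [b Db] := iota_sub a.
rewrite (gal_restrP (s * t)%g (esym Db)) !galM ?memvf //.
by symmetry; do 2!apply: gal_restrP.
Qed.

HB.instance Definition _ n :=
  isMultiplicative.Build _ _ (@gal_restr n) (@gal_restrM n).

(* The group G_Q(phi) is invlim gal_res.                                      *)
Definition gal_res n : {multiplicative gal_iter n.+1 -> gal_iter n} :=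
  @gal_restr n.

End Arboreal.

(* Wreath products of permutation groups: A wr B acts on X * Y, with B        *)
(* permuting the blocks {x} * Y and an element of A chosen in each block.     *)

Section Wreath.

Variables (X Y : finType) (A : {group {perm Y}}) (B : {group {perm X}}).

Definition wreath : {set {perm X * Y}} :=
  [set s : {perm X * Y} | [exists b in B, exists c : {ffun X -> {perm Y}},
    [forall x, (c x \in A) && [forall y, s (x, y) == (b x, c x y)]]]].

Lemma wreathP (s : {perm X * Y}) :
  reflect (exists2 b, b \in B & exists2 c : X -> {perm Y},
             forall x, c x \in A & forall x y, s (x, y) = (b x, c x y))
          (s \in wreath).
Proof.
rewrite inE; apply: (iffP exists_inP) => -[b Bb].
  case/existsP=> c /forallP cP; exists b => //; exists c => [x|x y].
    by case/andP: (cP x).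
  by case/andP: (cP x) => _ /forallP/(_ y)/eqP.
case=> c Ac sE; exists b => //; apply/existsP; exists (finfun c).
apply/forallP => x; rewrite ffunE Ac; apply/forallP => y.
by rewrite sE.
Qed.

Fact wreath_group_set : group_set wreath.
Proof.
apply/group_setP; split.
  apply/wreathP; exists 1%g => //; exists (fun=> 1%g) => // x y.
  by rewrite !perm1.
move=> s t /wreathP[b Bb [c Ac sE]] /wreathP[b' Bb' [c' Ac' tE]].
apply/wreathP; exists (b * b')%g; first exact: groupM.
exists (fun x => c x * c' (b x))%g => [x|x y]; first exact: groupM.
by rewrite !permM sE tE.
Qed.

Definition wreath_group : {group {perm X * Y}} := Group wreath_group_set.

Lemma wreath_top (s : [subg wreath_group]) :
  {b : [subg B] | forall x y, (sgval s (x, y)).1 = sgval b x}.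
Proof.
case: s => s /= /wreathP sW; apply: cid; have [b Bb [c _ sE]] := sW.
by exists (Subg Bb) => x y; rewrite sE.
Qed.

End Wreath.

(* The iterated wreath product [C_2]^n acts on the leaves of the complete     *)
(* binary rooted tree of height n.                                            *)

Definition C2 : {group {perm bool}} := <[tperm false true]>%G.

Fixpoint leaf n : finType :=
  if n is m.+1 then (leaf m * bool)%type else unit.

Fixpoint C2wr_group n : {group {perm leaf n}} :=
  if n is m.+1 then wreath_group C2 (C2wr_group m) else 1%G.

Definition C2wr n : groupType := [subg C2wr_group n].

(* [C_2]^(n+1) -> [C_2]^n forgets the last level of the tree.                 *)
Definition C2wr_restr n (s : C2wr n.+1) : C2wr n := sval (wreath_top s).

Lemma C2wr_restrP n (s : C2wr n.+1) x y :
  (sgval s (x, y)).1 = sgval (C2wr_restr s) x.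
Proof. exact: svalP (wreath_top s) x y. Qed.

Fact C2wr_restrM n : {morph @C2wr_restr n : s t / (s * t)%g}.
Proof.
move=> s t; apply: val_inj; apply/permP => x.
rewrite -[LHS]/(sgval (C2wr_restr (s * t)) x).
rewrite -[RHS]/((sgval (C2wr_restr s) * sgval (C2wr_restr t))%g x).
rewrite permM -(C2wr_restrP (s * t)%g x true).
rewrite -(C2wr_restrP s x true) /= permM.
rewrite -(C2wr_restrP t _ (sgval s (x, true)).2).
by rewrite -surjective_pairing.
Qed.

HB.instance Definition _ n :=
  isMultiplicative.Build _ _ (@C2wr_restr n) (@C2wr_restrM n).

(* The group [C_2]^infty is invlim C2wr_res.                                  *)
Definition C2wr_res n : {multiplicative C2wr n.+1 -> C2wr n} := @C2wr_restr n.

Definition phi_ (p : nat) : {poly rat} :=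
  ('X - p%:R%:P) ^+ 2 + (2 * p%:R - p%:R ^+ 2)%:P.

(* Main.v *)
Require Import Defs.
From HB Require Import structures.
From mathcomp Require Import all_classical topology.
From mathcomp Require Import all_boot all_fingroup all_solvable.
From mathcomp Require Import all_algebra all_field.
From mathcomp Require Import ring zify.

(** The map phi = phi_p sends z to (z - p)^2 + c with c = 2p - p^2, the image of
its critical point p.  The children of a vertex t of the tree of iterated
preimages of 0 are p + s and p - s with s^2 = t - c, so every automorphism of
the field of the 2^n roots of phi^n acts on the binary tree of height n
([tree_action]), faithfully because these roots generate the field.  The
inverse limits are isomorphic as soon as all these finite actions are onto
([invlim_isog_levelwise]).

Surjectivity is a statement about quadratic characters.  The group [C_2]^n is a
2-group, so a proper subgroup lies in a maximal one, which is the kernel of a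
nontrivial character to {1, -1}.  Every such character is a product of level
characters, the i-th of which counts modulo 2 the vertices of level i whose
children are exchanged ([level_charP]); so a proper subgroup is killed by the
product of the level characters over some nonempty set S of levels
([C2wr_generation]).

On the field side the i-th level character has a Kummer generator: the product
over the vertices t of level i of the square roots of t - c ([gap_prod]).  An
automorphism multiplies it by the value of the level character
([acts_as_gap_prod]), and its square is, up to a sign at the root, the value
phi^i(c), because phi^i is the product of the X - t.  This square is p d_i for
a sequence of positive integers d_0 = p - 2, d_1 = p^2 (p - 2) + 2,
d_(k+1) = p d_k (d_k - 2) + 2 for k at least 1 ([crit]).  If the Galois group were killed by the
product of the characters in S, the product of the generators would be
rational, and the product of the p d_i over S would be a perfect square.

The d_i are odd, prime to p, and pairwise coprime: modulo d_i all later terms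
are 2.  So such a product is a square only if every d_i with i in S is a
square and S has an even number of elements, hence at least two.  But at most
one d_i is a square ([crit_two_squares]).  Indeed, the d_k with k at least 3
are not squares modulo a suitable small integer, for each p considered; if
d_0 = p - 2 is a square, then p and all later terms are 3 modulo 4; and for p at
least 7 the product d_1 d_2 is never a square, by Runge's method, being a
polynomial in p of even degree and leading coefficient 1 which is not the
square of a polynomial. *)

Set Implicit Arguments.
Unset Strict Implicit.
Unset Printing Implicit Defensive.

Import GRing.Theory Num.Theory.

(** * Isomorphisms of inverse limits of discrete groups *)

Section InverseLimit.

Variables (G : nat -> groupType) (r : forall n, {multiplicative G n.+1 -> G n}).

Lemma invlim_proj_open (x : invlim r) n :
  nbhs x [set y : invlim r | invlim_proj y n = invlim_proj x n]%classic.
Proof.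
have c1 : continuous (fun y : invlim r => invlim_proj y n : discrete_topology (G n)).
  pose T n := discrete_topology (G n).
  move=> y; apply: (@continuous_comp _ _ _ (set_val : invlim r -> prod_topology T)
    (@proj nat T n) y).
    exact: initial_continuous.
  exact: (@proj_continuous nat T).
apply: (c1 x [set z : discrete_topology (G n) | z = invlim_proj x n]%classic).
exact: discrete_set1.
Qed.

(** Neighbourhoods in an inverse limit of discrete groups only constrain finitely
many components, so continuity can be checked one component at a time. *)
Lemma invlim_continuous (X : topologicalType) (f : X -> invlim r) :
  (forall x n, nbhs x [set y | invlim_proj (f y) n = invlim_proj (f x) n]%classic) ->
  continuous f.
Proof.
move=> cf; apply: continuous_comp_initial => x.
apply/cvg_sup => n U [?/= [[W oW <-]]] /= Wfx /filterS; apply.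
apply: filterS (cf x n) => y /= fy.
exact: (eq_ind_r W Wfx fy).
Qed.

End InverseLimit.

(** Continuity comes for free, since both towers consist of discrete groups: each
component of the image depends on one component of the argument, in both
directions. *)
Lemma invlim_isog_levelwise (G H : nat -> groupType)
    (r : forall n, {multiplicative G n.+1 -> G n})
    (s : forall n, {multiplicative H n.+1 -> H n})
    (F : forall n, G n -> H n) :
  (forall n, {morph F n : x y / (x * y)%g}) ->
  (forall n, bijective (F n)) ->
  (forall n x, s n (F n.+1 x) = F n (r n x)) ->
  invlim_isog r s.
Proof.
move=> FM Fbij Fc.
pose F' n := sval (cid2 (let: Bijective g fg gf := Fbij n in ex_intro2 _ _ g fg gf)).
have FK n : cancel (F n) (F' n) by rewrite /F'; case: cid2.
have F'K n : cancel (F' n) (F n) by rewrite /F'; case: cid2.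
have fP (x : invlim r) n : s n (F n.+1 (invlim_proj x n.+1)) = F n (invlim_proj x n).
  by rewrite Fc invlimP.
have gP (x : invlim s) n : r n (F' n.+1 (invlim_proj x n.+1)) = F' n (invlim_proj x n).
  by apply: (can_inj (FK n)); rewrite -Fc !F'K invlimP.
pose f x : invlim s := to_invlim (fP x).
pose g x : invlim r := to_invlim (gP x).
have fM : {morph f : x y / (x * y)%g}.
  by move=> x y; apply: invlim_ext => n; exact: FM.
pose fm := isMultiplicative.Build _ _ f fM.
pose f' : {multiplicative invlim r -> invlim s} := HB.pack f fm.
exists f', g; split.
- by move=> x; apply: invlim_ext => n; exact: FK.
- by move=> x; apply: invlim_ext => n; exact: F'K.
- apply: invlim_continuous => x n; apply: filterS (invlim_proj_open x n).
  by move=> y /= xy; congr (F n _).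
- apply: invlim_continuous => x n; apply: filterS (invlim_proj_open x n).
  by move=> y /= xy; congr (F' n _).
Qed.

(** * Quadratic characters of the automorphism group of the binary tree *)

Section TreeGroup.
Local Open Scope group_scope.
Implicit Types (n : nat).

Lemma perm_bool_C2 (c : {perm bool}) : c \in C2.
Proof.
suff -> : c = tperm false true ^+ (c true == false).
  by rewrite groupX // cycle_id.
have ctf : c false != c true by rewrite (inj_eq perm_inj).
apply/permP => b; case E : (c true == false) => /=.
  rewrite expg1; move/eqP: E => E; rewrite E in ctf.
  by case: b; rewrite ?tpermL ?tpermR //; case: (c false) ctf.
rewrite expg0 perm1; case: b; first by move: E; case: (c true).
by move: E ctf; case: (c true) => //; case: (c false).
Qed.

Lemma mem_C2wrS n (s : {perm leaf n.+1}) (w : {perm leaf n}) :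
  w \in C2wr_group n -> (forall x b, (s (x, b)).1 = w x) ->
  s \in C2wr_group n.+1.
Proof.
move=> wP sw.
have cP x : injective (fun b => (s (x, b)).2).
  move=> b b' e; suff [//] : (x, b) = (x, b').
  apply: (@perm_inj _ s); rewrite [LHS]surjective_pairing [RHS]surjective_pairing.
  by rewrite !sw e.
apply/wreathP; exists w => //; exists (fun x => perm (@cP x)) => [x|x b].
  exact: perm_bool_C2.
by rewrite permE -(sw x b) -surjective_pairing.
Qed.

Definition swap n (w : C2wr n.+1) (x : leaf n) : bool := ~~ (sgval w (x, true)).2.

Lemma C2wrE n (w : C2wr n.+1) x b :
  sgval w (x, b) = (sgval (C2wr_restr w) x, b (+) swap w x).
Proof.
rewrite [LHS]surjective_pairing C2wr_restrP; congr pair.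
have neq : sgval w (x, true) != sgval w (x, false).
  by rewrite (inj_eq perm_inj) xpair_eqE andbF.
rewrite /swap; case: b; first by rewrite addTb negbK.
move: neq; rewrite [sgval w _]surjective_pairing [sgval w (x, false)]surjective_pairing.
rewrite !C2wr_restrP xpair_eqE eqxx /=.
by case: (_ .2); case: (_ .2).
Qed.

Lemma swapM n (v w : C2wr n.+1) x :
  swap (v * w) x = swap v x (+) swap w (sgval (C2wr_restr v) x).
Proof. by rewrite {1}/swap /= permM C2wrE C2wrE /=; do 2!case: swap. Qed.

Fact flip_inj n (w : C2wr n) (a : leaf n -> bool) :
  injective (fun xb : leaf n.+1 => (sgval w xb.1, xb.2 (+) a xb.1)).
Proof.
by move=> [x b] [y c] [/perm_inj <- /addIb <-].
Qed.

Definition flip_perm n w a : {perm leaf n.+1} := perm (@flip_inj n w a).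

Fact flip_subproof n w a : @flip_perm n w a \in C2wr_group n.+1.
Proof.
by apply: (@mem_C2wrS _ _ (sgval w)) => [|x b]; rewrite ?subgP ?permE.
Qed.

(** Acts as [w] on the first [n] levels and exchanges, on the last one, the two
children above the vertices selected by [a]. *)
Definition flip n w a : C2wr n.+1 := Subg (@flip_subproof n w a).

Lemma flipE n (w : C2wr n) a x b : sgval (flip w a) (x, b) = (sgval w x, b (+) a x).
Proof. by rewrite permE. Qed.

Lemma C2wr_eq n (v w : C2wr n.+1) :
  C2wr_restr v = C2wr_restr w -> swap v =1 swap w -> v = w.
Proof.
by move=> e e'; apply/val_inj/permP => -[x b]; rewrite !C2wrE e e'.
Qed.

Lemma restr_flip n (w : C2wr n) a : C2wr_restr (flip w a) = w.
Proof.
by apply/val_inj/permP => x; rewrite -(C2wr_restrP _ x true) flipE.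
Qed.

Lemma swap_flip n (w : C2wr n) a : swap (flip w a) =1 a.
Proof. by move=> x; rewrite /swap flipE /= negbK. Qed.

Lemma flipM n (v w : C2wr n) a b :
  flip v a * flip w b = flip (v * w) (fun x => a x (+) b (sgval v x)).
Proof.
apply: C2wr_eq => [|x]; first by rewrite C2wr_restrM !restr_flip.
by rewrite swapM !swap_flip restr_flip.
Qed.

Lemma flip_decomp n (w : C2wr n.+1) :
  w = flip 1 (swap w) * flip (C2wr_restr w) (fun=> false).
Proof.
rewrite flipM mul1g; apply: C2wr_eq => [|x]; first by rewrite restr_flip.
by rewrite swap_flip addbF.
Qed.

Lemma C2wr0 (v w : C2wr 0) : v = w.
Proof. by apply/val_inj/permP => -[]; case: (sgval v _); case: (sgval w _). Qed.

Lemma C2wr_transitive n (x y : leaf n) : exists w : C2wr n, sgval w x = y.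
Proof.
elim: n x y => [|n IH]; first by move=> [] []; exists 1; exact: perm1.
move=> [x b] [y c]; have [w wx] := IH x y.
exists (flip w (fun=> b (+) c)); rewrite flipE wx /=.
by rewrite addbA addbb.
Qed.

Definition parity n (w : C2wr n.+1) : bool := \big[addb/false]_x swap w x.

(** The product of the level characters over the set of levels [S], written
additively: [false] stands for 1 and [true] for -1. *)
Fixpoint level_char n (S : pred nat) : C2wr n -> bool :=
  if n is m.+1 return C2wr n -> bool then
    fun w => (S m && parity w) (+) level_char S (C2wr_restr w)
  else fun=> false.

Lemma eq_level_char n (S T : pred nat) (w : C2wr n) :
  (forall i, i < n -> S i = T i) -> level_char S w = level_char T w.
Proof.
elim: n w => //= n IH w ST; rewrite ST // (IH (C2wr_restr w)) // => i lin.
exact/ST/leqW.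
Qed.

Lemma level_char0 n (S : pred nat) (w : C2wr n) :
  (forall i, i < n -> ~~ S i) -> level_char S w = false.
Proof.
elim: n w => //= n IH w ST; rewrite (negPf (ST n _)) // IH // => i lin.
exact/ST/leqW.
Qed.

(** The elements that act on the last level only form an elementary abelian
group, with one generator for each vertex whose children are exchanged.  These
generators are conjugate because the tree group is transitive on the vertices
of a level, so a character takes the same value on all of them. *)
Lemma char_flip n (chi : C2wr n.+1 -> bool) :
  {morph chi : v w / v * w >-> v (+) w} ->
  exists e, forall a, chi (flip 1 a) = e && \big[addb/false]_x a x.
Proof.
move=> chiM.
have chi1 : chi 1 = false by have := chiM 1 1; rewrite mulg1; case: (chi 1).
pose E x := chi (flip 1 (fun y => y == x)).
have Econst x y : E x = E y.
  (* Conjugation by a lift of w turns the generator at x into the one at y. *)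
  have [w wx] := C2wr_transitive x y.
  have : chi (flip w (fun=> false) * flip 1 (eq_op^~ y)) =
         chi (flip 1 (eq_op^~ x) * flip w (fun=> false)).
    congr chi; rewrite !flipM mulg1 mul1g; apply: C2wr_eq => [|z].
      by rewrite !restr_flip.
    by rewrite !swap_flip -wx (inj_eq perm_inj) addbF.
  by rewrite !chiM addbC => /addIb.
have chi_sum a (s : seq (leaf n)) : uniq s ->
    chi (flip 1 (fun x => (x \in s) && a x)) = \big[addb/false]_(x <- s) (a x && E x).
  elim: s => [|x s IH] => [_|/= /andP[xs us]].
    rewrite big_nil -chi1; congr chi; apply: C2wr_eq => [|x].
      rewrite restr_flip; apply/val_inj/permP => x.
      by rewrite -(C2wr_restrP _ x true) /= !perm1.
    by rewrite swap_flip /swap perm1.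
  rewrite big_cons -{}IH //; have [ax|ax] /= := boolP (a x).
    rewrite -chiM flipM mulg1; congr chi; apply: C2wr_eq => [|y].
      by rewrite !restr_flip.
    rewrite !swap_flip perm1 inE; case: (y =P x) => //= ->.
    by rewrite ax (negPf xs).
  congr chi; apply: C2wr_eq => [|y]; first by rewrite !restr_flip.
  by rewrite !swap_flip inE; case: (y =P x) => //= ->; rewrite (negPf ax) andbF.
have x0 : leaf n by elim: (n) => [|m x]; [exact: tt | exact: (x, true)].
exists (E x0) => a.
transitivity (chi (flip 1 (fun x => (x \in index_enum (leaf n)) && a x))).
  congr chi; apply: C2wr_eq => [|y]; first by rewrite !restr_flip.
  by rewrite !swap_flip mem_index_enum.
rewrite chi_sum ?index_enum_uniq //.
rewrite (eq_bigr (fun x => E x0 && a x)); last by move=> x _; rewrite andbC (Econst x x0).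
by case: (E x0) => //; rewrite big1.
Qed.

(** By [char_flip] a character agrees, on the elements that act on the last level
only, with the last level character or with the trivial one; dividing by it
leaves a character of the tree group of height one less. *)
Lemma level_charP n (chi : C2wr n -> bool) :
  {morph chi : v w / v * w >-> v (+) w} ->
  exists S : pred nat, chi =1 level_char S.
Proof.
elim: n chi => [|n IH] chi chiM.
  exists pred0 => w /=; rewrite (C2wr0 w 1).
  by have := chiM 1 1; rewrite mulg1; case: (chi 1).
have [e eP] := char_flip chiM.
have [|S SP] := IH (fun w => chi (flip w (fun=> false))).
  by move=> v w; rewrite -chiM flipM.
exists (fun i => if i == n then e else S i) => w.
rewrite {1}[w]flip_decomp chiM eP /= eqxx SP; congr (_ (+) _).
by apply: eq_level_char => i; case: eqP => // ->; rewrite ltnn.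
Qed.

Lemma C2wr_exp n (w : C2wr n) : w ^+ (2 ^ n) = 1.
Proof.
elim: n w => [|n IH] w; first exact: C2wr0.
have restrX m : C2wr_restr (w ^+ m) = C2wr_restr w ^+ m.
  elim: m => [|m IHm]; first by rewrite !expg0; exact: (gmulf1_r C2wr_res n).
  by rewrite !expgS C2wr_restrM IHm.
rewrite expnSr expgM; set v := w ^+ _.
have rv : C2wr_restr v = 1 by rewrite restrX IH.
rewrite expgS expg1 [v]flip_decomp rv !flipM !mulg1 /=.
apply/val_inj/permP => -[x b]; rewrite flipE !perm1 /=.
by rewrite !addbF addbb addbF.
Qed.

Lemma C2wr_pgroup n : 2.-group [set: [subg C2wr_group n]].
Proof.
rewrite -pnat_exponent; apply: (@pnat_dvd _ (2 ^ n)); last by rewrite pnatX.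
by apply/exponentP => w _; exact: C2wr_exp.
Qed.

Lemma index2_mulP (gT : finGroupType) (G M : {group gT}) :
  M \subset G -> #|G : M| = 2 ->
  {in G &, forall x y, (x * y \in M) = ((x \in M) == (y \in M))}.
Proof.
move=> sMG iM x y xG yG.
have [xM|xM] := boolP (x \in M); first by rewrite groupMl.
have [yM|yM] := boolP (y \in M); first by rewrite groupMr // (negPf xM).
rewrite eqxx -[y]invgK -mem_rcoset.
suff -> : M :* y^-1 = G :\: M by rewrite inE xM.
apply/eqP; rewrite eqEcard; apply/andP; split.
  apply/subsetP => z /rcosetP[m mM ->].
  rewrite inE groupMl // groupV yM groupM ?groupV //; exact: (subsetP sMG).
rewrite card_rcoset cardsD (setIidPr sMG).
by rewrite -(Lagrange sMG) iM muln2 -addnn addnK.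
Qed.

(** The level characters generate the dual of the Frattini quotient of the tree
group: a subgroup on which no nontrivial product of them vanishes is contained
in no maximal subgroup. *)
Lemma C2wr_generation n (H : {group [subg C2wr_group n]}) :
  (forall S : pred nat, {in H, forall w, level_char S w = false} ->
     forall i, i < n -> ~~ S i) ->
  H = [set: [subg C2wr_group n]] :> {set _}.
Proof.
move=> noS; apply/eqP; apply/negPn/negP => neq.
have [|M] := @maxgroup_exists _ (fun K => K \proper [set: [subg C2wr_group n]]) H.
  by rewrite properEneq neq subsetT.
move=> maxM sHM; have Mmax : maximal M [set: [subg C2wr_group n]] by [].
have iM := p_maximal_index (C2wr_pgroup n) Mmax.
have [|S SP] := @level_charP n (fun w => w \notin M).
  by move=> v w; rewrite (index2_mulP (subsetT M) iM) ?inE //; do 2!case: (_ \in M).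
have /properP[_ [w _ wM]] := maxgroupp Mmax.
move: wM; have /= -> := SP w; rewrite level_char0 //; apply: noS => v vH.
by rewrite -SP (subsetP sHM).
Qed.

End TreeGroup.

(** * Squares in the critical orbit *)

Section CriticalOrbit.
Local Open Scope nat_scope.

(** The orbit of the critical value [2 * p - p ^ 2] is [- (p * crit p 0)],
[p * crit p 1], [p * crit p 2], and so on ([iterp_critval] below).  The
auxiliary sequence, which is [crit p k.+1 - 2], gives a recurrence without
subtraction. *)
Fixpoint crit_aux (p k : nat) : nat :=
  if k is j.+1 then p * crit_aux p j * (crit_aux p j + 2) else p * p * (p - 2).

Definition crit (p k : nat) : nat := if k is j.+1 then crit_aux p j + 2 else p - 2.

Variable p : nat.
Hypotheses (p_prime : prime p) (p_gt2 : 2 < p).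

Let p_odd : odd p.
Proof. by case/even_prime: p_prime => // p2; move: p_gt2; rewrite p2. Qed.

(** Once a term of the orbit vanishes modulo an integer, the next one is 2, and 2
is a fixed point of [d |-> p * d * (d - 2) + 2]. *)
Lemma crit_auxS_dvd j k : j <= k -> crit p j %| crit_aux p k.
Proof.
elim: k => [|k IH]; first by case: j => // _ /=; rewrite dvdn_mull.
rewrite leq_eqVlt => /predU1P[->|]; first by rewrite /= dvdn_mull.
by rewrite ltnS => /IH jk; rewrite /= dvdn_mulr // dvdn_mull.
Qed.

Lemma crit_aux_odd k : odd (crit_aux p k).
Proof. by elim: k => [|k IH] /=; rewrite !(oddM, oddD, oddB) ?p_odd ?IH // ltnW. Qed.

Lemma crit_odd k : odd (crit p k).
Proof. by case: k => [|k]; rewrite /= ?oddB ?oddD ?crit_aux_odd ?p_odd // ltnW. Qed.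

Lemma crit_coprime j k : j < k -> coprime (crit p j) (crit p k).
Proof.
case: k => // k; rewrite ltnS => /crit_auxS_dvd/dvdnP[q e].
by rewrite /coprime /= e gcdnMDl -/(coprime _ _) coprimen2 crit_odd.
Qed.

Lemma crit_coprime_p k : coprime p (crit p k).
Proof.
case: k => [|k] /=.
  rewrite coprime_sym -{2}(subnK (ltnW p_gt2)) /coprime gcdnDl -/(coprime _ _).
  by rewrite coprimen2 (crit_odd 0).
have /dvdnP[q ->] : p %| crit_aux p k by case: k => [|k] /=; rewrite -mulnA dvdn_mulr.
by rewrite /coprime gcdnMDl -/(coprime _ _) coprimen2.
Qed.

Lemma coprime_mul_square (a b u : nat) :
  coprime a b -> a * b = u ^ 2 -> exists v, a = v ^ 2.
Proof.
move=> cab e; exists (gcdn a u); rewrite -mulnn.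
transitivity (a * gcdn (gcdn a u) (gcdn u b)).
  have /eqP-> := coprime_dvdl (dvdn_gcdl a u) (coprime_dvdr (dvdn_gcdr u b) cab).
  by rewrite muln1.
rewrite muln_gcdr [a * gcdn u b]muln_gcdr e -mulnn -muln_gcdl.
by rewrite [a * _]mulnC -muln_gcdr.
Qed.

Lemma mod4_square_ne3 (u : nat) : u ^ 2 %% 4 <> 3.
Proof.
by rewrite -modnXm; have := ltn_pmod u (isT : 0 < 4); case: (u %% 4) => [|[|[|[]]]].
Qed.

Lemma crit_mod4 k : p %% 4 = 3 -> crit p k.+1 %% 4 = 3.
Proof.
move=> p3 /=; suff e : crit_aux p k %% 4 = 1 by rewrite -modnDml e.
elim: k => [|k IH] /=.
  have p21 : (p - 2) %% 4 = 1 by move: p3 p_gt2; lia.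
  by rewrite -modnMm -(modnMm p p) p3 p21.
by rewrite -modnMm -(modnMm p) -(modnDml (crit_aux p k)) p3 IH.
Qed.

Lemma crit_mod4_square k a : p - 2 = a ^ 2 -> crit p k.+1 %% 4 = 3.
Proof.
move=> pa; apply: crit_mod4; have : a ^ 2 %% 4 = 1.
  have : odd (a ^ 2) by rewrite -pa -[p - 2]/(crit p 0) crit_odd.
  rewrite oddX -modnXm /= => oa.
  have : odd (a %% 4) by rewrite odd_mod.
  by have := ltn_pmod a (isT : 0 < 4); case: (a %% 4) => [|[|[|[]]]].
by rewrite -pa => e; rewrite -(subnK (ltnW p_gt2)) -modnDml e.
Qed.

(** Runge's method: the product of the two values is a polynomial in [p] of degree
10 with leading coefficient 1, and the polynomial part of its square root has
coefficients with denominator 8; so 64 times the product is close to the square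
of an integer, and lies strictly between two consecutive squares when [p] is at
least 7. *)
Lemma crit12_not_squares a b : crit p 1 = a ^ 2 -> crit p 2 = b ^ 2 -> False.
Proof.
rewrite /=; have [lt7|ge7] := ltnP p 7.
  have p35 : p = 3 \/ p = 5.
    by move: lt7 p_gt2 p_odd; case: (p) => [|[|[|[|[|[|[|?]]]]]]] //; auto.
  (* The first value is 11 or 77, which is 2 modulo 3. *)
  move=> ha _; have : a ^ 2 %% 3 <> 2.
    by rewrite -modnXm; have := ltn_pmod a (isT : 0 < 3); case: (a %% 3) => [|[|[]]].
  by rewrite -ha; case: p35 => ->.
set x := p - 7; have -> : p = x + 7 by rewrite subnK.
have -> : x + 7 - 2 = x + 5 by lia.
move=> ha hb.
set y := x + 7 in ha hb.
(* With y = p, the number B.+1 is 8 y^5 - 24 y^4 + 12 y^3 + 20 y^2 - 13 y - 5, *)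
(* which is 8 times the polynomial part of the square root.                   *)
pose B := 8 * y ^ 4 * (x + 4) + 12 * y ^ 3 + y * (20 * x + 126) + x.+1.
have upper : (8 * (a * b)) ^ 2 < B.+1 ^ 2.
  rewrite (_ : B.+1 ^ 2 = (8 * (a * b)) ^ 2 +
             (8 * y ^ 3 * (9 * x + 31) + 225 * y ^ 2 + 130 * x + 679)).
    by rewrite -addn1 leq_add2l addn_gt0 orbT.
  by rewrite !expnMn -ha -hb /B /y; ring.
have lower : B ^ 2 < (8 * (a * b)) ^ 2.
  rewrite (_ : (8 * (a * b)) ^ 2 = B ^ 2 + (8 * y ^ 3 * (2 * x ^ 2 + 13 * x) +
             190 * y ^ 3 + 34 * x * y ^ 2 + y * (53 * x + 215) + 220)).
    by rewrite -addn1 leq_add2l addn_gt0 orbT.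
  by rewrite !expnMn -ha -hb /B /y; ring.
by move: upper lower; rewrite !ltn_exp2r // ltnS leqNgt => /negP.
Qed.

(** If the first term [p - 2] is a square, then [p] is 3 modulo 4 and so are all the
other terms; otherwise only the terms of index 1 and 2 are left, and
[crit12_not_squares] applies to them. *)
Lemma crit_two_squares i j a b :
  (forall k c, 3 <= k -> crit p k <> c ^ 2) ->
  i < j -> crit p i = a ^ 2 -> crit p j = b ^ 2 -> False.
Proof.
move=> nonsq; case: j => // j; case: i => [|i] lij ha hb.
  by have := @mod4_square_ne3 b; rewrite -hb (crit_mod4_square _ ha).
have j2 : j.+1 < 3 by rewrite ltnNge; apply/negP => /nonsq/(_ hb).
have [i0 j1] : i = 0 /\ j = 1 by split; lia.
by move: ha hb; rewrite i0 j1; exact: crit12_not_squares.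
Qed.

(** Coprimality splits a square product into square factors, and the exponent of
[p] in it, which is the number of factors, must be even: a nonempty product
then involves two square terms. *)
Lemma prod_crit_not_square n (S : pred nat) u i0 :
  (forall k c, 3 <= k -> crit p k <> c ^ 2) ->
  i0 < n -> S i0 -> \prod_(i < n | S i) (p * crit p i) = u ^ 2 -> False.
Proof.
move=> nonsq lin Si0 prodE.
have p_gt0 : 0 < p by apply: leq_trans p_gt2.
pose A := [pred i : 'I_n | S i].
have squares (i : 'I_n) : S i -> exists v, crit p i = v ^ 2.
  pose rest := \prod_(j < n | S j && (j != i)) (p * crit p j).
  move=> Si; apply: (@coprime_mul_square _ (p * rest) u).
    rewrite coprimeMr coprime_sym crit_coprime_p /=.
    rewrite /rest; elim/big_ind: _ => [|x y cx cy|j /andP[_ nji]]; first exact: coprimen1.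
      by rewrite coprimeMr cx.
    rewrite coprimeMr coprime_sym crit_coprime_p /=.
    have [lt|lt|/val_inj/eqP] := ltngtP i j; first exact: crit_coprime.
      by rewrite coprime_sym crit_coprime.
    by rewrite eq_sym (negPf nji).
  by rewrite -prodE [RHS](bigD1 i) //= mulnA [crit p i * p]mulnC.
have even_card : ~~ odd #|A|.
  have [||v vE] := @coprime_mul_square (p ^ #|A|) (\prod_(i < n | S i) crit p i) u.
  - apply: coprimeXl; elim/big_ind: _ => [|x y cx cy|j _]; first exact: coprimen1.
      by rewrite coprimeMr cx.
    exact: crit_coprime_p.
  - by rewrite -prodE big_split /= prod_nat_const.
  have := congr1 (logn p) vE; rewrite !lognX logn_prime // eqxx muln1 => ->.
  by rewrite mul2n odd_double.
have [j Aj nj] : exists2 j, j \in A & j != Ordinal lin.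
  have : 0 < #|[predD1 A & Ordinal lin]|.
    move: even_card; rewrite (cardD1 (Ordinal lin)) inE [S _]Si0.
    by case: #|_|.
  by case/card_gt0P => j /andP[nj Aj]; exists j.
have [[v vE] [w wE]] := (squares (Ordinal lin) Si0, squares _ Aj).
by have [lt|lt|/val_inj/eqP] := ltngtP j (Ordinal lin);
   [exact: (crit_two_squares nonsq lt wE vE) |
    exact: (crit_two_squares nonsq lt vE wE) | rewrite (negPf nj)].
Qed.

End CriticalOrbit.

Section ModularOrbit.
Local Open Scope nat_scope.

Definition crit_step m r e := (r * e %% m * (e + 2)) %% m.

(** Tests that no [crit p k] with [3 <= k] is a square modulo [m], for [p] congruent
to [r]: the orbit modulo [m] is followed from the auxiliary value of index 2, and
[looping] certifies that its first [m] terms contain all the others. *)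
Definition orbit_avoids_squares m r : bool :=
  let f := crit_step m r in
  let e := f (f (r * r * (r + m - 2) %% m)) in
  looping f e m &&
  all (fun e => (e + 2) %% m \notin [seq i * i %% m | i <- iota 0 m]) (traject f e m).

Lemma crit_aux_mod m p k : 1 < m -> 1 < p ->
  crit_aux p k %% m =
    iter k (crit_step m (p %% m)) (p %% m * (p %% m) * (p %% m + m - 2) %% m).
Proof.
move=> m1 p1; elim: k => [|k IH] /=.
  have p2E : p - 2 = p %% m + m - 2 %[mod m].
    rewrite -[LHS]modnDr -(modnMDl (p %/ m) (p %% m + m - 2)).
    by congr (_ %% m); rewrite {1}(divn_eq p m) in p1 *; lia.
  by rewrite -modnMm -(modnMm p p) p2E modnMm.
rewrite -IH /crit_step modnMml.
by rewrite -modnMm -(modnMm p) -(modnDml (crit_aux p k)) modnMm.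
Qed.

Lemma orbit_avoids_squaresP m p : 1 < m -> 1 < p ->
  orbit_avoids_squares m (p %% m) -> forall k c, 3 <= k -> crit p k <> c ^ 2.
Proof.
move=> m1 p1 /andP[/loopingP loop /allP nsq] [|[|[|k]]] // c _ pk.
have := nsq _ (loop k); rewrite -!iterSr -crit_aux_mod // modnDml.
rewrite -[crit_aux p k.+2 + 2]/(crit p k.+3) pk -mulnn => /negP; apply.
apply/mapP; exists (c %% m); last by rewrite modnMm.
by rewrite mem_iota ltn_pmod // ltnW.
Qed.

(** Each modulus comes with residues of [p] that pass the test.  The moduli beyond
13 take care of the primes below 5000 that the smaller ones leave out. *)
Definition avoiding_residues : seq (nat * seq nat) :=
  [:: (3, [:: 0; 2]); (8, [:: 0; 2; 3; 4; 5; 6; 7]); (5, [:: 0; 2]); (7, [:: 3; 6]);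
      (11, [:: 0; 2; 3; 5; 7; 10]); (13, [:: 0; 2; 3; 7; 9; 11]);
      (17, [:: 6; 12; 13; 14; 15]); (19, [:: 0; 2; 7; 13; 14; 18]);
      (31, [:: 6; 8; 23; 24; 30]); (41, [:: 12; 19; 24; 27; 29; 30])].

Lemma small_primes_avoid_squares p : prime p -> 2 < p < 5000 ->
  exists2 m, 1 < m & orbit_avoids_squares m (p %% m).
Proof.
move=> p_prime /andP[p_gt2 p_lt].
have /allP table_ok : all (fun mr => (1 < mr.1) && all (orbit_avoids_squares mr.1) mr.2)
  avoiding_residues by vm_compute.
(* A conditional instead of a disjunction, so that the costly primality test  *)
(* is evaluated only for the few p that the table does not cover.             *)
have /allP all_ok : all (fun p => if has (fun mr => p %% mr.1 \in mr.2) avoiding_residues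
    then true else (p < 3) || ~~ prime p) (iota 0 5000) by vm_compute.
have /all_ok : p \in iota 0 5000 by rewrite mem_iota.
case: ifP => [/hasP[[m rs] /table_ok /= /andP[m1 /allP rs_ok] /rs_ok] | _].
  by exists m.
by rewrite ltnNge p_gt2 p_prime.
Qed.

Lemma residue_avoid_squares p :
  (p = 2 %[mod 3]
   \/ p = 3 %[mod 4]
   \/ p = 2 %[mod 5]
   \/ p %% 7 \in [:: 3; 6]
   \/ p %% 11 \in [:: 2; 3; 5; 7; 10]
   \/ p %% 13 \in [:: 2; 3; 7; 9; 11]) ->
  exists2 m, 1 < m & orbit_avoids_squares m (p %% m).
Proof.
have avoid m s : all (orbit_avoids_squares m) s -> 1 < m -> p %% m \in s ->
    exists2 m, 1 < m & orbit_avoids_squares m (p %% m).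
  by move=> /allP s_ok m1 /s_ok; exists m.
case=> [e|]; first by apply: (avoid 3 [:: 2] _ isT); [vm_compute | rewrite e].
case=> [e|]; first by apply: (avoid 4 [:: 3] _ isT); [vm_compute | rewrite e].
case=> [e|]; first by apply: (avoid 5 [:: 2] _ isT); [vm_compute | rewrite e].
case=> [|]; first by apply: (avoid 7 [:: 3; 6] _ isT); vm_compute.
case=> [|]; first by apply: (avoid 11 [:: 2; 3; 5; 7; 10] _ isT); vm_compute.
by apply: (avoid 13 [:: 2; 3; 7; 9; 11] _ isT); vm_compute.
Qed.

End ModularOrbit.

(** * The Galois action on the tree of preimages *)

Section Roots.
Local Open Scope ring_scope.

Variable p : nat.
Hypotheses (p_prime : prime p) (p_gt2 : (2 < p)%N).

Local Notation pQtoC := (map_poly (@ratr algC)).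
Local Notation critval := (2 * p%:R - p%:R ^+ 2 : algC).
Local Notation phiC z := (((z : algC) - p%:R) ^+ 2 + critval).

Lemma phi_C : pQtoC (phi_ p) = ('X - p%:R%:P) ^+ 2 + critval%:P.
Proof.
have ratr_val : ratr (2 * p%:R - p%:R ^+ 2) = critval.
  by rewrite rmorphB rmorphM rmorphXn !rmorph_nat.
have map_C c : pQtoC c%:P = (ratr c)%:P by exact: map_polyC.
rewrite /phi_ rmorphD rmorphXn rmorphB /= map_polyX !map_C.
by rewrite ratr_nat ratr_val.
Qed.

(** Half the difference of the two preimages of [z], with an arbitrary choice of
sign. *)
Definition half_gap (z : algC) : algC := sqrtC (z - critval).

Lemma half_gap_sqr z : half_gap z ^+ 2 = z - critval.
Proof. exact: sqrtCK. Qed.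

(** Labels the leaves of the tree of height [n] by the roots of the [n]-th iterate,
so that the two children of a vertex are its two preimages under [phi_ p]. *)
Fixpoint tree_root n : leaf n -> algC :=
  if n is m.+1 return leaf n -> algC then
    fun xb => p%:R + (-1) ^+ xb.2 * half_gap (tree_root xb.1)
  else fun=> 0.

Lemma phi_tree_root n (x : leaf n) b :
  phiC (tree_root ((x, b) : leaf n.+1)) = tree_root x.
Proof.
by rewrite /= [p%:R + _]addrC addrK exprMn sqrr_sign mul1r half_gap_sqr subrK.
Qed.

Lemma iterp_C n :
  pQtoC (iterp (phi_ p) n) = \prod_(x : leaf n) ('X - (tree_root x)%:P).
Proof.
elim: n => [|n IH]; first by rewrite map_polyX (big_pred1 tt) ?subr0 // => -[].
rewrite iterpSr map_comp_poly IH rmorph_prod /= phi_C.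
rewrite -(pair_bigA _ (fun x b => 'X - (tree_root ((x, b) : leaf n.+1))%:P)) /=.
apply: eq_bigr => x _; rewrite rmorphB /= comp_polyX comp_polyC big_bool /=.
rewrite expr1 expr0 mulN1r mul1r.
set s := half_gap (tree_root x).
have -> : tree_root x = s ^+ 2 + critval by rewrite half_gap_sqr subrK.
rewrite !(polyCD, polyCN) polyC_exp; ring.
Qed.

Lemma mem_rootsC_iterp n z :
  reflect (exists x : leaf n, z = tree_root x) (z \in rootsC (iterp (phi_ p) n)).
Proof.
have iterp0 : iterp (phi_ p) n != 0.
  rewrite -(map_poly_eq0 (@ratr algC)) iterp_C monic_neq0 //.
  exact: monic_prod_XsubC.
rewrite mem_rootsC iterp0 iterp_C /= /root horner_prod.
apply: (iffP (prodf_eq0 _ _)) => [[x _]|[x ->]].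
  by rewrite hornerXsubC subr_eq0 => /eqP; exists x.
by exists x => //; rewrite hornerXsubC subrr.
Qed.

(** The value at 0 carries a sign because [2 * p - p ^ 2] is negative, whereas all
its images are positive. *)
Lemma iterp_critval n : (pQtoC (iterp (phi_ p) n)).[critval] =
  if n is 0 then - (p * crit p 0)%:R else (p * crit p n)%:R.
Proof.
have pE : (p - 2)%:R = p%:R - 2 :> algC by rewrite natrB // ltnW.
elim: n => [|n IH]; first by rewrite map_polyX hornerX natrM /= pE; ring.
rewrite /= map_comp_poly horner_comp -/(iterp _ _) IH phi_C !(hornerE, horner_exp) /=.
case: n {IH} => [|n]; rewrite /= !(natrM, natrD) ?pE; ring.
Qed.

Lemma card_leaf n : #|{: leaf n}| = (2 ^ n)%N.
Proof.
by elim: n => [|n IH]; rewrite ?card_unit // card_prod IH card_bool expnSr.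
Qed.

(** The Kummer generator of the quadratic character [parity] of level [n]. *)
Definition gap_prod n : algC := \prod_(x : leaf n) half_gap (tree_root x).

(** The square is the product of the [t - c] over the roots [t] of the [n]-th
iterate, which is the value of that iterate at the critical value [c], up to
the sign [(-1) ^ (2 ^ n)]: this is -1 only for [n = 0], where it cancels the
sign of [c]. *)
Lemma gap_prod_sqr n : gap_prod n ^+ 2 = (p * crit p n)%:R.
Proof.
rewrite /gap_prod -prodrXl (eq_bigr (fun x => - (critval - tree_root x))); last first.
  by move=> x _; rewrite half_gap_sqr [RHS]opprB.
rewrite (eq_bigl [in {: leaf n}]) // prodrN card_leaf.
have -> : \prod_(x : leaf n) (critval - tree_root x) =
          (pQtoC (iterp (phi_ p) n)).[critval].
  by rewrite iterp_C horner_prod; apply: eq_bigr => x _; rewrite hornerXsubC.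
rewrite iterp_critval; case: n => [|n]; first by rewrite expr1 mulN1r opprK.
by rewrite expnS exprM sqrrN expr1n expr1n mul1r.
Qed.

(** The critical value is not a root of any iterate, so no two leaves have the same
label. *)
Lemma half_gap_neq0 n (x : leaf n) : half_gap (tree_root x) != 0.
Proof.
have : gap_prod n != 0.
  rewrite -sqrf_eq0 gap_prod_sqr pnatr_eq0 -lt0n muln_gt0 prime_gt0 //=.
  by rewrite odd_gt0 // crit_odd.
by move/prodf_neq0 => /(_ x isT).
Qed.

Lemma tree_root_inj n : injective (@tree_root n).
Proof.
elim: n => [|n IH] [] => [|x b] [] // y c e.
have exy : x = y by apply: IH; rewrite -(phi_tree_root x b) -(phi_tree_root y c) e.
move: e; rewrite exy /= => /addrI/(mulIf (half_gap_neq0 y)).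
by move/signr_inj => ->.
Qed.

Definition acts_as n (nu : algC -> algC) (w : C2wr n) :=
  forall x, nu (tree_root x) = tree_root (sgval w x).

Section Automorphism.
Variable nu : {rmorphism algC -> algC}.

Lemma nu_critval : nu critval = critval.
Proof. by rewrite rmorphB rmorphM rmorphXn /= !rmorph_nat. Qed.

Lemma acts_as_restr n (w : C2wr n.+1) :
  acts_as nu w -> acts_as nu (C2wr_restr w).
Proof.
move=> nuw x; rewrite -(phi_tree_root x true) rmorphD nu_critval rmorphXn rmorphB.
by rewrite rmorph_nat nuw C2wrE phi_tree_root.
Qed.

Lemma acts_as_half_gap n (w : C2wr n.+1) (x : leaf n) : acts_as nu w ->
  nu (half_gap (tree_root x)) =
    (-1) ^+ swap w x * half_gap (tree_root (sgval (C2wr_restr w) x)).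
Proof.
move=> /(_ (x, false)); rewrite C2wrE /= expr0 mul1r rmorphD rmorph_nat.
by move/addrI.
Qed.

(** An automorphism permutes the factors, up to one sign for each vertex whose
children it exchanges relative to the chosen square roots. *)
Lemma acts_as_gap_prod n (w : C2wr n.+1) :
  acts_as nu w -> nu (gap_prod n) = (-1) ^+ parity w * gap_prod n.
Proof.
move=> nuw; rewrite /gap_prod rmorph_prod (eq_bigr _ (fun x _ => acts_as_half_gap x nuw)).
rewrite big_split /=; congr (_ * _); last first.
  by rewrite [RHS](reindex_inj (@perm_inj _ (sgval (C2wr_restr w)))).
apply/esym/(@big_morph _ _ (fun b : bool => (-1) ^+ b : algC) 1 *%R false addb).
  exact: signr_addb.
exact: expr0.
Qed.

(** An automorphism sends the half gap at [x] to a square root of the half gap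
squared at the image of [x]; the sign decides whether it exchanges the children
of [x]. *)
Lemma acts_as_exists n : exists w : C2wr n, acts_as nu w.
Proof.
elim: n => [|n [w nuw]]; first by exists 1%g => x; rewrite /= rmorph0.
pose a x := nu (half_gap (tree_root x)) != half_gap (tree_root (sgval w x)).
have nu_gap x :
    nu (half_gap (tree_root x)) = (-1) ^+ a x * half_gap (tree_root (sgval w x)).
  rewrite /a; case: eqP => [->|/eqP neq]; first by rewrite mul1r.
  have : nu (half_gap (tree_root x)) ^+ 2 == half_gap (tree_root (sgval w x)) ^+ 2.
    by rewrite -rmorphXn /= !half_gap_sqr rmorphB nu_critval nuw.
  by rewrite eqf_sqr (negPf neq) /= mulN1r => /eqP.
exists (flip w a) => -[x b]; rewrite flipE /= rmorphD rmorphM rmorph_sign rmorph_nat.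
by rewrite nu_gap mulrA signr_addb.
Qed.

Lemma acts_as_prod_gaps n (S : pred nat) (w : C2wr n) : acts_as nu w ->
  nu (\prod_(i < n | S i) gap_prod i) =
    (-1) ^+ level_char S w * \prod_(i < n | S i) gap_prod i.
Proof.
elim: n w => [|n IH] w nuw; first by rewrite big_ord0 rmorph1 mulr1.
rewrite big_mkcond big_ord_recr -big_mkcond /= rmorphM (IH _ (acts_as_restr nuw)).
rewrite signr_addb; case: (S n) => /=; last by rewrite rmorph1 !mulr1 mul1r.
by rewrite (acts_as_gap_prod nuw) mulrACA [_ * (-1) ^+ parity w]mulrC.
Qed.

End Automorphism.

(** Membership in the splitting field of the [n]-th iterate, seen inside [algC]. *)
Definition in_level n (z : algC) := exists a, iota_ (phi_ p) n a = z.

Lemma in_levelW m n z : (m <= n)%N -> in_level m z -> in_level n z.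
Proof.
move/subnK <-; elim: (n - m)%N => [|k IH] // zm.
by have [a <-] := IH zm; have [b <-] := iota_sub a; exists b.
Qed.

Lemma tree_root_in_level n (x : leaf n) : in_level n (tree_root x).
Proof.
have [s Ds _] := splitting_field_gen (iterp (phi_ p) n).
have : tree_root x \in rootsC (iterp (phi_ p) n) by apply/mem_rootsC_iterp; exists x.
by rewrite -Ds => /mapP[a _ ->]; exists a.
Qed.

Lemma gap_prod_in_level n : in_level n.+1 (gap_prod n).
Proof.
have gap_in x : in_level n.+1 (half_gap (tree_root (x : leaf n))).
  have [a Da] := tree_root_in_level ((x, false) : leaf n.+1).
  exists (a - p%:R); rewrite rmorphB rmorph_nat Da /=.
  by rewrite mul1r [p%:R + _]addrC addrK.
rewrite /gap_prod; elim/big_ind: _ => [|_ _ [a <-] [b <-]|x _]; last exact: gap_in.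
  by exists 1; rewrite rmorph1.
by exists (a * b); rewrite rmorphM.
Qed.

Lemma prod_gaps_in_level n (S : pred nat) :
  in_level n (\prod_(i < n | S i) gap_prod i).
Proof.
elim/big_ind: _ => [|_ _ [a <-] [b <-]|i _].
- by exists 1; rewrite rmorph1.
- by exists (a * b); rewrite rmorphM.
- exact: in_levelW (ltn_ord i) (gap_prod_in_level i).
Qed.

(** Extending [tau] to an automorphism of [algC] allows the action on all levels to
be computed on algebraic numbers, without transport between the fields [K_]. *)
Lemma gal_acts_as n (tau : gal_iter (phi_ p) n) :
  {w : C2wr n | exists2 nu : {rmorphism algC -> algC},
     acts_as nu w & forall a, iota_ (phi_ p) n (tau a) = nu (iota_ (phi_ p) n a)}.
Proof.
apply: cid; have [nu nuP] := extend_algC_subfield_aut (iota_ (phi_ p) n) tau.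
by have [w nuw] := acts_as_exists nu n; exists w; exists nu.
Qed.

Definition tree_action n (tau : gal_iter (phi_ p) n) : C2wr n := sval (gal_acts_as tau).

Lemma tree_actionP n (tau : gal_iter (phi_ p) n) a x :
  iota_ (phi_ p) n a = tree_root x ->
  iota_ (phi_ p) n (tau a) = tree_root (sgval (tree_action tau) x).
Proof.
by move=> Da; rewrite /tree_action; case: gal_acts_as => w [nu /= nuw ->]; rewrite Da nuw.
Qed.

Lemma tree_action_eq n (v w : C2wr n) :
  (forall x, tree_root (sgval v x) = tree_root (sgval w x)) -> v = w.
Proof. by move=> vw; apply/val_inj/permP => x; apply: tree_root_inj; exact: vw. Qed.

Lemma tree_actionM n : {morph @tree_action n : s t / (s * t)%g}.
Proof.
move=> s t; apply: tree_action_eq => x; have [a Da] := tree_root_in_level x.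
by rewrite -(tree_actionP _ Da) galM ?memvf //= permM; do 2!apply: tree_actionP.
Qed.

Lemma tree_action_restr n (tau : gal_iter (phi_ p) n.+1) :
  C2wr_restr (tree_action tau) = tree_action (gal_restr tau).
Proof.
apply: tree_action_eq => x; have [a Da] := tree_root_in_level x.
have [b Db] := iota_sub a.
rewrite -(tree_actionP _ Da) (gal_restrP tau (esym Db)).
rewrite /tree_action; case: (gal_acts_as tau) => w [nu /= nuw ->].
by rewrite Db Da (acts_as_restr nuw).
Qed.

Lemma tree_action_inj n : injective (@tree_action n).
Proof.
move=> s t st; pose g := (s * t^-1)%g.
have [rs Drs gen] := splitting_field_gen (iterp (phi_ p) n).
have : (<<1 & rs>> <= fixedField [set g])%VS.
  apply/Fadjoin_seqP; split=> [|a a_rs]; first exact: sub1v.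
  apply/fixedFieldP => [|_ /set1P->]; first exact: memvf.
  have /mem_rootsC_iterp[x Dx] : iota_ (phi_ p) n a \in rootsC (iterp (phi_ p) n).
    by rewrite -Drs map_f.
  have sa : s a = t a.
    by apply: (fmorph_inj (iota_ (phi_ p) n)); rewrite !(tree_actionP _ Dx) st.
  by rewrite galM ?memvf // sa -galM ?memvf // mulgV gal_id.
rewrite gen => /subvP fixg; apply/eqP; rewrite eq_mulgV1; apply/gal_eqP => a _.
have /mem_fixedFieldP[_ /(_ g (set11 g)) ->] := fixg a (memvf a).
by rewrite gal_id.
Qed.

(** The fixed field of the whole Galois group is [rat], the extension being
separable in characteristic 0. *)
Lemma gal_fixed_rat n (a : K_ (phi_ p) n) :
  (forall tau : gal_iter (phi_ p) n, tau a = a) -> exists q : rat, a = q%:A.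
Proof.
move=> fix_a; apply/vlineP; set L := K_ (phi_ p) n in a fix_a *.
have /galois_fixedField <- : galois 1 {:L}.
  apply/and3P; split; [exact: sub1v | | exact: normalFieldf].
  apply/separableP => y _; apply: pcharf0_separable => q.
  by rewrite pchar_lalg pchar_num.
by apply/fixedFieldP => [|tau _]; rewrite ?memvf ?fix_a.
Qed.

Hypothesis crit_nonsq : forall k c, (3 <= k)%N -> crit p k <> (c ^ 2)%N.

(** A rational value would be an algebraic integer, hence an integer, whose square
is a product excluded by [prod_crit_not_square]. *)
Lemma prod_gaps_not_rat n (S : pred nat) q i :
  (i < n)%N -> S i -> \prod_(i < n | S i) gap_prod i != ratr q.
Proof.
move=> lin Si; apply/eqP => prodE.
pose N := (\prod_(i < n | S i) (p * crit p i))%N.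
have sqN : ratr q ^+ 2 = N%:R :> algC.
  rewrite -prodE -prodrXl natr_prod; apply: eq_bigr => j _; exact: gap_prod_sqr.
have /intrP[z Dz] : (ratr q : algC) \in Num.int.
  apply: Cint_rat_Aint; first exact: Crat_rat.
  apply: (@root_monic_Aint ('X^2 - N%:R%:P)).
  - by rewrite /root !(hornerE, horner_exp) sqN subrr.
  - exact: monicXnsubC.
  - by apply/polyOverP => j; rewrite coefB coefXn coefC rpredB ?rpred_nat //;
       case: eqP => _; rewrite ?rpred_nat ?rpred0.
apply: (@prod_crit_not_square p p_prime p_gt2 n S `|z|%N i crit_nonsq lin Si).
apply/eqP; rewrite -(eqr_nat algC) -/N -sqN Dz natrX.
by rewrite natr_absz intr_norm real_normK ?realz.
Qed.

(** If the image were killed by the product of the level characters in [S], the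
product of the corresponding [gap_prod i] would be fixed by the Galois group,
hence rational. *)
Lemma tree_action_bij n : bijective (@tree_action n).
Proof.
have im_all : [set: [subg C2wr_group n]] =
    (@tree_action n @: [set: gal_of {:K_ (phi_ p) n}])%SET.
  pose f : {morphism [set: gal_of {:K_ (phi_ p) n}] >-> [subg C2wr_group n]} :=
    Morphism (in2W (@tree_actionM n)).
  have -> : (@tree_action n @: setT)%SET = (f @* setT)%G by rewrite /= morphimEdom.
  apply/esym/C2wr_generation => S S0 i lin; apply/negP => Si.
  have [d Dd] := prod_gaps_in_level n S.
  have [|q Dq] := @gal_fixed_rat n d.
    move=> tau; apply: (fmorph_inj (iota_ (phi_ p) n)).
    have : level_char S (tree_action tau) = false.
      by apply: S0; rewrite /= morphimEdom imset_f ?inE.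
    rewrite /tree_action; case: (gal_acts_as tau) => w [nu nuw nuE] /= w0.
    by rewrite nuE Dd (acts_as_prod_gaps _ nuw) w0 mul1r.
  have /eqP[] := prod_gaps_not_rat q lin Si.
  by rewrite -Dd Dq alg_num_field fmorph_rat.
have surj (w : [subg C2wr_group n]) : exists tau, tree_action tau = w.
  have : w \in [set: [subg C2wr_group n]] by rewrite inE.
  by rewrite im_all => /imsetP[tau _ ->]; exists tau.
pose g w := sval (cid (surj w)).
have gK : cancel g (@tree_action n) by move=> w; rewrite /g; case: cid.
by exists g => // tau; apply: tree_action_inj; rewrite gK.
Qed.

Lemma gal_iter_isog : invlim_isog (gal_res (phi_ p)) C2wr_res.
Proof.
apply: (@invlim_isog_levelwise _ _ _ _ (@tree_action)).
- exact: tree_actionM.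
- exact: tree_action_bij.
- exact: tree_action_restr.
Qed.

End Roots.

Theorem theorem1p2 (p : nat) (p_prime : prime p) (p_ge3 : 3 <= p) :
  (p = 2 %[mod 3]
   \/ p = 3 %[mod 4]
   \/ p = 2 %[mod 5]
   \/ p %% 7 \in [:: 3; 6]
   \/ p %% 11 \in [:: 2; 3; 5; 7; 10]
   \/ p %% 13 \in [:: 2; 3; 7; 9; 11] ->
   invlim_isog (gal_res (phi_ p)) C2wr_res)
  /\ (p < 5000 -> invlim_isog (gal_res (phi_ p)) C2wr_res).
Proof.
have isog m : 1 < m -> orbit_avoids_squares m (p %% m) ->
    invlim_isog (gal_res (phi_ p)) C2wr_res.
  move=> m_gt1 m_ok; apply: gal_iter_isog => //.
  by apply: (orbit_avoids_squaresP m_gt1 _ m_ok); exact: prime_gt1.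
split=> [/residue_avoid_squares | p_lt].
  by case=> m m_gt1; exact: isog.
have [|m m_gt1] := small_primes_avoid_squares p_prime; first by rewrite p_ge3.
exact: isog.
Qed.
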